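(* Let $TL$ be a part of a triangular lattice and let $\widehat{TL}=F(TL)$ be its image under a discrete immersion $F$, with cross-ratio function $q$. Let $v_0$ be an interior vertex of $TL$ with neighbors $v_1,\dots,v_6$ in cyclic order, and put $z_k=F(v_k)$ for $k=0,\dots,6$ (indices $1,\dots,6$ are taken modulo $6$). For the flower of $\widehat{TL}$ about $z_0$ with neighbors $z_1,\dots,z_6$ the following statements are equivalent. (i) The flower is conformally symmetric. (ii) Opposite cross-ratios agree, that is, $q([v_0,v_k])=q([v_0,v_{k+3}])$ for $k=1,2,3$. (iii) The circles/lines $C_k$, $k=1,2,3$, where $C_k$ passes through $z_k,z_0,z_{k+3}$, have a second common intersection point $X\in\mathbb{C}\cup\{\infty\}$, apart from $z_0$, which satisfies $\mathrm{cr}(z_k,z_0,z_{k+3},X)=-1$ for $k=1,2,3$.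
   Context: A triangular lattice is a lattice triangulation of the whole plane $\mathbb{C}$ with congruent triangles; $TL$ is a (part of a) triangular lattice. A vertex is interior if it is an interior point of the union of its adjacent closed triangles; an interior vertex with its six incident triangles is a flower. A discrete immersion $F:TL\to\mathbb{C}$ is a map that is continuous, affine-linear on every triangle and orientation preserving, such that for every flower the image triangles intersect pairwise only in their common vertex or edge. Cross-ratio: $\mathrm{cr}(z_1,z_2,z_3,z_4)=\frac{(z_1-z_2)(z_3-z_4)}{(z_2-z_3)(z_4-z_1)}$ (extended to $\infty$ by continuity). The cross-ratio function of $F$ on interior edges is $q([v_i,v_j])=\mathrm{cr}(F(v_i),F(v_l),F(v_j),F(v_k))$, where $\Delta[v_i,v_j,v_k]$ and $\Delta[v_i,v_l,v_j]$ are the two triangles adjacent to $[v_i,v_j]$, with vertices listed counterclockwise. The flower with center $z_0$ and neighbors $z_1,\dots,z_6$ in cyclic order is conformally symmetric if there is an involutive M\''obius transformation $M$ with fixed point $z_0$ such that $M(z_k)=z_{k+3}$ for all $k$ modulo $6$. *)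

(* Defs.v *)
From HB Require Import structures.
From mathcomp Require Import all_boot all_order all_algebra.
From mathcomp Require Import all_classical all_reals all_analysis.
From mathcomp Require Import complex ring lra.
Set Implicit Arguments.
Unset Strict Implicit.
Unset Printing Implicit Defensive.
Import Order.TTheory GRing.Theory Num.Theory.
Import numFieldNormedType.Exports.
Local Open Scope classical_set_scope.
Local Open Scope complex_scope.
Local Open Scope ring_scope.

(* The usual topology of the complex plane: an abstract numFieldType gets it
   from numFieldNormedType.Exports, but the concrete type R[i] does not. *)
HB.instance Definition _ (R : realType) := NormedModule.copy R[i] (R[i]^o).

(** * The Riemann sphere *)

(* [Some z] is the finite point z, [None] is the point at infinity. *)
Definition sphere (R : realType) := option R[i].

Section Sphere.
Context {R : realType}.
Implicit Types p : sphere R.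

(* Homogeneous coordinates: [Some z] is (z : 1) and [None] is (1 : 0). *)
Definition hx p : R[i] := if p is Some z then z else 1.
Definition hy p : R[i] := if p is Some _ then 1 else 0.
Definition of_hom (x y : R[i]) : sphere R :=
  if y == 0 then None else Some (x / y).

(* For finite points [hdiff (Some z) (Some w)] is z - w.  In [cr], numerator and
   denominator are homogeneous of the same degree in each of the points, so
   this is the continuous extension of the usual formula to infinity.  The
   value is meaningless (0/0) when three of the four points coincide. *)
Definition hdiff p1 p2 := hx p1 * hy p2 - hx p2 * hy p1.
Definition cr p1 p2 p3 p4 : sphere R :=
  of_hom (hdiff p1 p2 * hdiff p3 p4) (hdiff p2 p3 * hdiff p4 p1).

Lemma cr_fin (z1 z2 z3 z4 : R[i]) : z2 != z3 -> z4 != z1 ->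
  cr (Some z1) (Some z2) (Some z3) (Some z4) =
  Some ((z1 - z2) * (z3 - z4) / ((z2 - z3) * (z4 - z1))).
Proof.
rewrite -(subr_eq0 z2) -(subr_eq0 z4) => h1 h2.
by rewrite /cr /of_hom /hdiff /= !mulr1 mulf_eq0 (negPf h1) (negPf h2).
Qed.

Definition mobius (a b c d : R[i]) p : sphere R :=
  of_hom (a * hx p + b * hy p) (c * hx p + d * hy p).

Definition is_mobius (M : sphere R -> sphere R) :=
  exists a b c d, a * d - b * c != 0 /\ M =1 mobius a b c d.

Definition is_circle (C : set (sphere R)) := exists c r : R[i],
  0 < r /\ C = Some @` [set z | `|z - c| = r].

Definition is_line (C : set (sphere R)) := exists p d : R[i],
  d != 0 /\ C = None |` (Some @` [set p + t%:C * d | t in [set: R]]).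

Definition circle_or_line (C : set (sphere R)) := is_circle C \/ is_line C.

End Sphere.

(** * Triangular lattices *)

(* The points lat_o + m lat_a + n lat_b (m, n integers); the edges have the
   directions lat_a, lat_b and lat_b - lat_a.  Exchanging lat_a and lat_b does
   not change the triangulation, so that requiring the basis to be positively
   oriented is no restriction. *)
Record tri_lattice (R : realType) := TriLattice {
  lat_o : R[i];
  lat_a : R[i];
  lat_b : R[i];
  lat_ccw : 0 < 'Im (lat_a^* * lat_b)
}.

(* (m, n, true) and (m, n, false) are the two halves of the cell
   lat_o + [m, m + 1] lat_a + [n, n + 1] lat_b. *)
Definition face := (int * int * bool)%type.

Section Lattice.
Context {R : realType}.
Variable L : tri_lattice R.

Definition node (m n : int) : R[i] :=
  lat_o L + m%:~R * lat_a L + n%:~R * lat_b L.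

(* The vertices of a face, listed counterclockwise. *)
Definition corner (f : face) (i : 'Z_3) : R[i] :=
  let: (m, n, up) := f in
  (if up then [:: node m n; node (m + 1) n; node m (n + 1)]
   else [:: node (m + 1) (n + 1); node m (n + 1); node (m + 1) n])`_i.

Definition vertex_of (p : R[i]) (f : face) := exists i, p = corner f i.

Definition triangle (f : face) : set R[i] :=
  [set x | exists t : 'Z_3 -> R,
     [/\ forall i, 0 <= t i, \sum_i t i = 1 & x = \sum_i (t i)%:C * corner f i]].

(* A part of the triangular lattice is given by the set TL of its faces. *)
Variable TL : set face.

Definition support : set R[i] := \bigcup_(f in TL) triangle f.

(* p, r, s are the vertices of a face of TL in counterclockwise order. *)
Definition ccw_face (p r s : R[i]) := exists2 f, TL f &
  exists i : 'Z_3, [/\ p = corner f i, r = corner f (i + 1) & s = corner f (i + 2)].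

Definition interior_vertex (p : R[i]) :=
  (\bigcup_(f in [set f | TL f /\ vertex_of p f]) triangle f)° p.

(* v lists the six neighbours of p in cyclic order, in either direction. *)
Definition cyclic_neighbors (p : R[i]) (v : 'Z_6 -> R[i]) :=
  injective v /\
  ((forall k, ccw_face p (v k) (v (k + 1))) \/
   (forall k, ccw_face p (v (k + 1)) (v k))).

(* Every real affine map of the plane can be written z |-> a z + b z^* + c, and
   its Jacobian is `|a| ^+ 2 - `|b| ^+ 2. *)
Definition affine_orientation_preserving_on (A : set R[i]) (F : R[i] -> R[i]) :=
  exists a b c : R[i], `|b| < `|a| /\ forall z, A z -> F z = a * z + b * z^* + c.

(* Only the values of F on [support] matter.  Two different faces f, g at p meet
   exactly in their common vertex or edge, which is [triangle f `&` triangle g]. *)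
Definition discrete_immersion (F : R[i] -> R[i]) :=
  [/\ {within support, continuous F},
      forall f, TL f -> affine_orientation_preserving_on (triangle f) F &
      forall p, interior_vertex p -> forall f g, TL f -> TL g ->
        vertex_of p f -> vertex_of p g -> f != g ->
        F @` triangle f `&` F @` triangle g = F @` (triangle f `&` triangle g)].

(* The third vertex of the face of TL to the left of the oriented edge from p
   to r; it is unique by [left_apexE]. *)
Definition left_apex (p r : R[i]) : R[i] := xget 0 [set s | ccw_face p r s].

(* The value on the edge [p, r], where left_apex p r and left_apex r p are the
   third vertices of the two adjacent faces. *)
Definition cross_ratio_function (F : R[i] -> R[i]) (p r : R[i]) : sphere R :=
  cr (Some (F p)) (Some (F (left_apex r p)))
     (Some (F r)) (Some (F (left_apex p r))).

Lemma left_apexE p r s : ccw_face p r s -> left_apex p r = s.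
Proof.
pose a := lat_a L; pose b := lat_b L.
pose k (u w : R[i]) := u^* * w - u * w^*.
have k0 : k a b != 0.
  apply/eqP => k0; have := lat_ccw L.
  rewrite -/a -/b; set c := _ * _.
  suff /Creal_ImP -> : c \is Num.real by rewrite ltxx.
  by rewrite CrealE /c rmorphM /= conjCK eq_sym -subr_eq0; exact/eqP.
have key x y z : ccw_face x y z ->
    k a b * (z - x) = k (y - x) b * b + k a (y - x) * (b - a).
  move=> [[[m n] up] _ [i [-> -> ->]]].
  case: up; case: i => [[|[|[|//]]] hi]; rewrite /= /node !rmorphD /=
    -/a -/b /k !(rmorphB, rmorphD, rmorphM, rmorph_int, rmorph1, rmorphN) /=; ring.
move=> h; rewrite /left_apex; case: xgetP => [w _ hw|/(_ s)//].
by apply: (addIr (- p)); apply: (mulfI k0); rewrite (key _ _ _ hw) (key _ _ _ h).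
Qed.

End Lattice.

(** * Conformally symmetric flowers *)

(* [involutive M] alone would allow the identity; here it is excluded because
   z k and z (k + 3) are distinct in every immersed flower. *)
Definition conformally_symmetric (R : realType) (z0 : R[i]) (z : 'Z_6 -> R[i]) :=
  exists M : sphere R -> sphere R,
    [/\ is_mobius M, involutive M, M (Some z0) = Some z0 &
        forall k, M (Some (z k)) = Some (z (k + 3))].

(* Main.v *)
Require Import Defs.
From mathcomp Require Import all_boot all_order all_algebra.
From mathcomp Require Import all_classical all_reals all_analysis.
From mathcomp Require Import complex.
From mathcomp Require Import ring.
Set Implicit Arguments.
Unset Strict Implicit.
Unset Printing Implicit Defensive.
Import Order.TTheory GRing.Theory Num.Theory.
Import numFieldNormedType.Exports.
Local Open Scope classical_set_scope.
Local Open Scope complex_scope.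
Local Open Scope ring_scope.

(** Move the center z0 of the flower to infinity by the coordinate
    w = 1 / (z - z0) and write w_k for the image of z_k.  Each of the three
    statements then says that the opposite sums w_k + w_(k+3) do not depend
    on k ([constant_opposite_sums]).

    - A Moebius involution fixing z0 becomes an affine involution of the
      w-plane; if it is not the identity, it is a half-turn w |-> s - w.  So (i)
      asks for a half-turn that exchanges opposite points w_k and w_(k+3)
      ([mobius_half_turn], [mobius_involutive_half_turn]).

    - The cross-ratio on [v0, v_k] becomes - d_k / d_(k-1) or its inverse,
      depending on the direction in which the neighbors are listed, where
      d_k = w_(k+1) - w_k ([cr_center]).  So (ii) says that the
      ratio of consecutive sides of the closed hexagon w_1 ... w_6 is the same
      at opposite corners, hence d_(k+3) = l d_k for one number l.  The sides add
      up to 0, so (1 + l) (w_3 - w_0) = 0.  Since opposite vertices of the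
      flower have different images, l = -1, which makes the opposite sums
      constant ([opposite_ratiosP]).

    - The condition cr (z_k, z0, z_(k+3), X) = -1 says that the coordinate of X is
      the midpoint of w_k and w_(k+3) ([cr_harmonicP]); a common X exists
      exactly when the three midpoints coincide.  The circles of (iii) are then
      the preimages of the lines through w_k and w_(k+3)
      ([circle_or_line_coord_line]).

    The immersion enters only through the injectivity of F on the closed
    triangles around v0 taken together ([immersion_flower_inj]), which makes
    the seven points z0, ..., z6 distinct. *)

(** * Injectivity of an immersion on a flower *)

Section Injectivity.
Context {R : realType}.

(** If x and y have the same image then a (x - y) = - b (x - y)^*, and comparing
    absolute values forces x = y because `|b| < `|a|. *)
Lemma affine_orientation_preserving_inj (A : set R[i]) (F : R[i] -> R[i]) x y :
  affine_orientation_preserving_on A F -> A x -> A y -> F x = F y -> x = y.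
Proof.
move=> [a [b [c [ltba Fl]]]] Ax Ay; rewrite !Fl // => /addIr eqF.
have E : a * (x - y) = - (b * (x - y)^*).
  apply/eqP; rewrite -subr_eq0 opprK rmorphB /=.
  have -> : a * (x - y) + b * (x^* - y^*) =
            (a * x + b * x^*) - (a * y + b * y^*) by ring.
  by rewrite eqF subrr.
have := congr1 (@Num.norm _ R[i]) E.
rewrite normrN !normrM norm_conjC => /eqP; rewrite -subr_eq0 -mulrBl mulf_eq0.
by rewrite subr_eq0 gt_eqF //= normr_eq0 subr_eq0 => /eqP.
Qed.

Variable L : tri_lattice R.

Lemma corner_triangle (f : face) i : triangle L f (corner L f i).
Proof.
exists (fun j => (j == i)%:R); split.
- by move=> j; rewrite ler0n.
- by rewrite (bigD1 i) //= eqxx big1 ?addr0 // => j /negPf->.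
- by rewrite (bigD1 i) //= eqxx mul1r big1 ?addr0 // => j /negPf->; rewrite mul0r.
Qed.

(** The three edge vectors lat_a, lat_b and lat_b - lat_a of the lattice are
    nonzero since the basis is positively oriented. *)
Lemma corner_succ_neq (f : face) i : corner L f i != corner L f (i + 1).
Proof.
have h := lat_ccw L.
have a0 : lat_a L != 0.
  by apply: contraTneq h => ->; rewrite conjC0 mul0r raddf0 ltxx.
have b0 : lat_b L != 0.
  by apply: contraTneq h => ->; rewrite mulr0 raddf0 ltxx.
have ab : lat_a L - lat_b L != 0.
  rewrite subr_eq0; apply: contraTneq h => ->.
  by rewrite mulrC -normCK (Creal_ImP _ _) ?ltxx // rpredX // normr_real.
rewrite -subr_eq0; case: f => [[m n] up].
by case: up; case: i => [[|[|[|//]]] hi]; rewrite /= /node !rmorphD /=;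
  [rewrite -oppr_eq0; move: a0 | move: ab | move: b0
  |move: a0|rewrite -oppr_eq0; move: ab | rewrite -oppr_eq0; move: b0];
  congr (_ != 0); ring.
Qed.

Variables (TL : set face) (F : R[i] -> R[i]).

(** A common value of F at x in f and y in g is, by the intersection condition,
    also taken at a common point of f and g; injectivity on each of the two
    triangles identifies this point with x and with y. *)
Lemma immersion_flower_inj (p : R[i]) (f g : face) (x y : R[i]) :
  discrete_immersion L TL F -> interior_vertex L TL p ->
  TL f -> TL g -> vertex_of L p f -> vertex_of L p g ->
  triangle L f x -> triangle L g y -> F x = F y -> x = y.
Proof.
move=> [_ Faff Fsep] pin TLf TLg pf pg fx gy Fxy.
have injF h (TLh : TL h) a b : triangle L h a -> triangle L h b ->
    F a = F b -> a = b.
  exact: affine_orientation_preserving_inj (Faff h TLh).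
have [fg|fg] := eqVneq f g; first by apply: (injF f) => //; rewrite fg.
have : (F @` triangle L f `&` F @` triangle L g) (F x).
  by split; [exists x | rewrite Fxy; exists y].
rewrite (Fsep p pin f g TLf TLg pf pg fg) => -[x' [fx' gx'] Fx'].
by rewrite -(injF f TLf _ _ fx' fx Fx') (injF g TLg _ _ gx' gy) // Fx'.
Qed.

Lemma ccw_face_rot (p r s : R[i]) : ccw_face L TL p r s -> ccw_face L TL s p r.
Proof.
move=> [f TLf [i [-> -> ->]]]; exists f => //; exists (i + 2).
by split=> //; congr (corner L f _); apply: val_inj; case: i => [[|[|[|]]]].
Qed.

Lemma ccw_face_inj (p0 r r' s s' : R[i]) (x y : R[i]) :
  discrete_immersion L TL F -> interior_vertex L TL p0 ->
  ccw_face L TL p0 r s -> ccw_face L TL p0 r' s' ->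
  x \in [:: p0; r; s] -> y \in [:: p0; r'; s'] -> F x = F y -> x = y.
Proof.
move=> Fi p0i [f TLf [i [Ep Er Es]]] [g TLg [j [Ep' Er' Es']]] xf yg Fxy.
apply: (immersion_flower_inj Fi p0i TLf TLg _ _ _ _ Fxy);
  [by exists i | by exists j | |].
- by move: xf; rewrite !inE => /or3P[] /eqP ->; rewrite ?Ep ?Er ?Es;
    apply: corner_triangle.
- by move: yg; rewrite !inE => /or3P[] /eqP ->; rewrite ?Ep' ?Er' ?Es';
    apply: corner_triangle.
Qed.

Lemma ccw_face_neq p r s : ccw_face L TL p r s -> p != r.
Proof. by move=> [f _ [i [-> -> _]]]; exact: corner_succ_neq. Qed.

End Injectivity.

(** * The coordinate with a pole at the center of the flower *)

Section Coordinate.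
Context {R : realType}.
Implicit Types (z : R[i]) (X : sphere R).

Definition pole_coord z0 X : R[i] := if X is Some z then (z - z0)^-1 else 0.

Lemma pole_coord_surj z0 (y : R[i]) : exists2 X, X <> Some z0 & pole_coord z0 X = y.
Proof.
have [->|y0] := eqVneq y 0; first by exists None.
exists (Some (z0 + y^-1)); last by rewrite /= addrC addKr invrK.
by move=> [] /eqP; rewrite -subr_eq0 addrC addKr invr_eq0 (negPf y0).
Qed.

Lemma pole_coord_inj z0 z1 z2 :
  pole_coord z0 (Some z1) = pole_coord z0 (Some z2) -> z1 = z2.
Proof. by move=> /invr_inj /addIr. Qed.

(** Sending z0 to infinity turns a cross-ratio into a ratio of differences;
    here this is the cross-ratio on the edge from z0 to z. *)
Lemma cr_center z0 zp z zn : zp != z0 -> z != z0 -> zn != z0 -> zp != z ->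
  let w u := pole_coord z0 (Some u) in
  cr (Some z0) (Some zp) (Some z) (Some zn) =
  Some (- ((w zn - w z) / (w z - w zp))).
Proof.
move=> p0 k0 n0 pk w; rewrite cr_fin //; congr Some; rewrite /w /=.
move: p0 k0 n0 pk; rewrite -!(subr_eq0 _ z0) -(subr_eq0 zp).
have -> : zp - z = (zp - z0) - (z - z0) by ring.
have -> : z - zn = (z - z0) - (zn - z0) by ring.
rewrite -[z0 - zp]opprB.
move: (zp - z0) (z - z0) (zn - z0) => p k n p0 k0 n0 pk.
by field; rewrite ?mulN1r p0 k0 n0 pk.
Qed.

(** A fourth harmonic point with respect to infinity is a midpoint. *)
Lemma cr_harmonicP z0 z z' X : z != z0 -> z' != z0 -> z != z' -> X <> Some z0 ->
  let w := pole_coord z0 in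
  cr (Some z) (Some z0) (Some z') X = Some (- 1) <->
  w (Some z) + w (Some z') = 2 * w X.
Proof.
rewrite -!(subr_eq0 _ z0) => P0 Q0 zz' Xz0 w.
have iff_factor (x y u v c : R[i]) : c != 0 -> x - y = (u - v) * c ->
    Some x = Some y <-> u = v.
  move=> c0 E; split=> [[]|] /eqP; rewrite -subr_eq0 ?E.
    by rewrite mulf_eq0 (negPf c0) orbF subr_eq0 => /eqP.
  by move=> /eqP uv; congr Some; apply/eqP; rewrite -subr_eq0 E uv mul0r.
case: X Xz0 => [x xz0|_].
  have Y0 : x - z0 != 0 by rewrite subr_eq0; apply/eqP => E; apply: xz0; rewrite E.
  (* For X = z the cross-ratio is infinite, and w X = w z is the midpoint of w z
     and w z' only if z = z'. *)
  have [->|xz] := eqVneq x z.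
    split.
      by rewrite /cr /of_hom /hdiff /= !mulr1 subrr mulr0 eqxx.
    rewrite mulr_natl mulr2n => /addrI /pole_coord_inj zz.
    by rewrite zz eqxx in zz'.
  rewrite cr_fin // 1?eq_sym -?(subr_eq0 z')//.
  apply: (iff_factor _ _ _ _ ((z - z0) * (x - z0) / (x - z))).
    by rewrite !mulf_neq0 // invr_eq0 subr_eq0.
  move: xz; rewrite -subr_eq0 /w /=.
  have -> : x - z = (x - z0) - (z - z0) by ring.
  have -> : z' - x = (z' - z0) - (x - z0) by ring.
  rewrite -[z0 - z']opprB.
  move: (x - z0) (z - z0) (z' - z0) Y0 P0 Q0 => y p q y0 p0 q0 yp.
  by field; rewrite ?mulN1r p0 q0 y0 yp.
have -> : cr (Some z) (Some z0) (Some z') None = Some ((z - z0) / (z' - z0)).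
  rewrite /cr /of_hom /hdiff /= !(mulr0, mulr1, mul1r, sub0r, subr0).
  rewrite subr_eq0 eq_sym -subr_eq0 (negPf Q0) mulrN1; congr Some.
  by rewrite -[z0 - z']opprB invrN mulrNN.
apply: (iff_factor _ _ _ _ (z - z0)) => //; rewrite /w /=.
by move: (z - z0) (z' - z0) P0 Q0 => p q p0 q0; field; rewrite p0 q0.
Qed.

(** * Half-turns as Moebius involutions *)

(** Homogeneous coordinates are recovered up to a nonzero factor; with
    [of_hom_scale] this lets Moebius maps be composed without separating the
    point at infinity. *)
Lemma hom_coordP (x y : R[i]) : (x != 0) || (y != 0) ->
  exists2 k, k != 0 & hx (of_hom x y) = k * x /\ hy (of_hom x y) = k * y.
Proof.
rewrite /of_hom; have [->|y0 _] := eqVneq y 0.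
  rewrite orbF => x0; exists x^-1; first by rewrite invr_eq0.
  by rewrite /= mulr0 mulVf.
by exists y^-1; rewrite ?invr_eq0 //= mulVf // mulrC.
Qed.

Lemma of_hom_scale (k x y : R[i]) : k != 0 -> of_hom (k * x) (k * y) = of_hom x y.
Proof.
move=> k0; rewrite /of_hom mulf_eq0 (negPf k0) /=.
by case: eqVneq => // y0; rewrite -mulf_div divff // mul1r.
Qed.

Lemma hom_coordK X : of_hom (hx X) (hy X) = X.
Proof. by case: X => [z|]; rewrite /of_hom /= ?eqxx // oner_eq0 divr1. Qed.

(** The square of a matrix of trace 0 is scalar, by the Cayley-Hamilton theorem. *)
Lemma mobius_trace0_involutive (a b c : R[i]) :
  a ^+ 2 + b * c != 0 -> involutive (mobius a b c (- a)).
Proof.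
move=> det0 X.
set x := hx X; set y := hy X.
have xy0 : (x != 0) || (y != 0).
  by rewrite /x /y; case: (X) => [?|] /=; rewrite oner_eq0 ?orbT.
have Ex : a * (a * x + b * y) + b * (c * x + - a * y) = (a ^+ 2 + b * c) * x.
  by ring.
have Ey : c * (a * x + b * y) + - a * (c * x + - a * y) = (a ^+ 2 + b * c) * y.
  by ring.
have nz : (a * x + b * y != 0) || (c * x + - a * y != 0).
  move: xy0; apply: contraLR; rewrite !negb_or !negbK => /andP[/eqP E1 /eqP E2].
  move/eqP: Ex; move/eqP: Ey; rewrite E1 E2 !mulr0 addr0 ![0 == _]eq_sym.
  by rewrite !mulf_eq0 (negPf det0) /= => -> ->.
have [k k0 [Hx Hy]] := hom_coordP nz.
rewrite {1}/mobius -/(mobius _ _ _ _ _) {1 2}/mobius -/x -/y Hx Hy.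
rewrite !(mulrCA _ k) -!mulrDr of_hom_scale // Ex Ey of_hom_scale //.
exact: hom_coordK.
Qed.

Lemma of_homE (x y z : R[i]) : of_hom x y = Some z <-> y != 0 /\ x = z * y.
Proof.
rewrite /of_hom; case: eqVneq => [_|y0]; split=> //.
- by case.
- by case=> <-; rewrite divfK.
- by case=> _ ->; rewrite mulfK.
Qed.

(** The map is w |-> s - w in the coordinate with pole z0, written out in z. *)
Lemma mobius_half_turn z0 (s : R[i]) : exists M : sphere R -> sphere R,
  [/\ is_mobius M, involutive M, M (Some z0) = Some z0 &
      forall z z', z != z0 -> z' != z0 ->
        pole_coord z0 (Some z) + pole_coord z0 (Some z') = s ->
        M (Some z) = Some z'].
Proof.
pose a := s * z0 + 1; pose b := - (s * z0 + 2) * z0.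
have det : a ^+ 2 + b * s = 1 by rewrite /a /b; ring.
exists (mobius a b s (- a)); split.
- exists a, b, s, (- a); split=> //.
  have -> : a * - a - b * s = - (a ^+ 2 + b * s) by ring.
  by rewrite det oppr_eq0 oner_eq0.
- by apply: mobius_trace0_involutive; rewrite det oner_eq0.
- apply/of_homE; rewrite /= !mulr1.
  have -> : s * z0 - a = - 1 by rewrite /a; ring.
  by rewrite oppr_eq0 oner_eq0; split=> //; rewrite /a /b; ring.
move=> z z'; rewrite -!(subr_eq0 _ z0) /= => P0 Q0 Es.
apply/of_homE; rewrite /= !mulr1.
have Ed : s * z - a = (z - z0) / (z' - z0).
  have -> : s * z - a = s * (z - z0) - 1 by rewrite /a; ring.
  by rewrite -Es; move: (z - z0) (z' - z0) P0 Q0 => p q p0 q0; field; rewrite p0 q0.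
rewrite Ed; split; first by rewrite mulf_neq0 ?invr_eq0.
have -> : a * z + b = z0 * (s * z - a) + (z - z0) by rewrite /a /b; ring.
by rewrite Ed -[X in _ + X = _](divfK Q0); ring.
Qed.

(** The two equations M z = z' and M z' = z, for z <> z', force the matrix of M to
    have trace 0; then the value at z0 determines the sum of the
    coordinates of z and z' from the bottom row alone. *)
Lemma mobius_involutive_half_turn z0 (M : sphere R -> sphere R) :
  is_mobius M -> involutive M -> M (Some z0) = Some z0 ->
  exists s, forall z z', z != z0 -> z' != z0 -> z != z' ->
    M (Some z) = Some z' ->
    pole_coord z0 (Some z) + pole_coord z0 (Some z') = s.
Proof.
move=> [a [b [c [d [_ EM]]]]] invM.
rewrite EM => /of_homE; rewrite /= !mulr1 => -[D0 E0].
exists (- c / (c * z0 + d)) => z z' P0 Q0 zz' Mz.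
have Mz' : M (Some z') = Some z by rewrite -Mz invM.
move: Mz Mz'; rewrite !EM => /of_homE[_] /= E1 /of_homE[_] /= E2.
rewrite !mulr1 in E1 E2.
have ad : d = - a.
  move: zz'; rewrite -subr_eq0 => zz'; apply: (mulIf zz'); apply/eqP.
  rewrite -subr_eq0; apply/eqP.
  have -> : d * (z - z') - - a * (z - z') =
     (a * z + b - z' * (c * z + d)) - (a * z' + b - z * (c * z' + d)) by ring.
  by rewrite E1 E2 !subrr.
have F : (c * z0 + d) * ((z - z0) + (z' - z0)) + c * ((z - z0) * (z' - z0)) = 0.
  transitivity (- (a * z + b - z' * (c * z + d))
                + (a * z0 + b - z0 * (c * z0 + d))); first by rewrite ad; ring.
  by rewrite E1 E0 !subrr oppr0 addr0.
move: P0 Q0; rewrite -!(subr_eq0 _ z0) /= => P0 Q0.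
move: (z - z0) (z' - z0) (c * z0 + d) P0 Q0 D0 F => p q D p0 q0 D0 F.
apply/eqP; rewrite -subr_eq0; apply/eqP.
transitivity ((D * (p + q) + c * (p * q)) / (D * p * q)).
  by field; rewrite ?mulN1r p0 q0 D0.
by rewrite F mul0r.
Qed.

(** * Preimages of lines in the coordinate *)

(** The inverse of a line is a line through z0 if the line passes through 0,
    that is, if a d^* is real, and a circle through z0 otherwise.  In the second
    case the line has the equation e w + (e w)^* = 1 with
    e = d^* / (a d^* - a^* d), which for w = 1 / (z - z0) says that
    `|z - z0 - e| = `|e|. *)
Lemma circle_or_line_coord_line z0 (a d : R[i]) : d != 0 ->
  exists C : set (sphere R), [/\ circle_or_line C, C (Some z0) &
    forall X (t : R), X <> Some z0 -> pole_coord z0 X = a + t%:C * d -> C X].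
Proof.
move=> d0.
have dc0 : d^* != 0 by rewrite conjC_eq0.
have conjr (t : R) : (t%:C)^* = t%:C :> R[i].
  by rewrite conj_Creal //; apply/complex_realP; exists t.
have [re|k0] := eqVneq (a * d^*) (a^* * d).
  have [s Es] : exists s : R, a = s%:C * d.
    have /complex_realP[s Es] : a / d \is Num.real.
      rewrite CrealE rmorphM fmorphV /=; apply/eqP.
      by apply: (mulIf d0); apply: (mulIf dc0); rewrite divfK // re mulrAC divfK.
    by exists s; rewrite -Es divfK.
  exists (None |` (Some @` [set z0 + t%:C * d^* | t in [set: R]])); split.
  - by right; exists z0, d^*.
  - by right; exists z0 => //; exists 0 => //; rewrite mul0r addr0.
  move=> [z|] t Xz0 Ez; last by left.
  right; exists z => //.
  have z0' : z - z0 != 0 by rewrite subr_eq0; apply/eqP => E; apply: Xz0; rewrite E.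
  have [r Er] : exists r : R, (s%:C + t%:C)^-1 * (d * d^*)^-1 = r%:C.
    have /complex_realP[r Er] : (s%:C + t%:C)^-1 * (d * d^*)^-1 \is Num.real.
      by rewrite CrealE rmorphM !fmorphV rmorphD !rmorphM /= !conjr conjCK (mulrC d).
    by exists r.
  exists r => //; rewrite -Er invfM -!mulrA mulVf // mulr1 -invfM.
  by rewrite mulrDl -Es -Ez invrK addrC subrK.
have kn : a * d^* - a^* * d != 0 by rewrite subr_eq0.
set k := _ - _ in kn.
have Ek : k^* = - k by rewrite /k rmorphB !rmorphM /= !conjCK; ring.
pose e := d^* / k.
have Ee : e^* = - (d / k) by rewrite /e rmorphM fmorphV /= conjCK Ek invrN mulrN.
have e0 : e != 0 by rewrite /e mulf_neq0 ?invr_eq0.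
exists (Some @` [set z | `|z - (z0 + e)| = `|e|]); split.
- by left; exists (z0 + e), `|e|; split=> //; rewrite normr_gt0.
- by exists z0 => //=; rewrite opprD addrA subrr sub0r normrN.
move=> X t Xz0 EX.
have line : e * (pole_coord z0 X) + (e * (pole_coord z0 X))^* = 1.
  rewrite EX rmorphM /= Ee rmorphD rmorphM /= conjr /e.
  have -> : d^* / k * (a + t%:C * d) + - (d / k) * (a^* + t%:C * d^*)
     = (a * d^* - a^* * d) / k by ring.
  by rewrite -/k divff.
case: X Xz0 EX line => [z Xz0 _ /= line|_ _ /=]; last first.
  by rewrite mulr0 conjC0 addr0 => /esym/eqP; rewrite oner_eq0.
have z0' : z - z0 != 0 by rewrite subr_eq0; apply/eqP => E; apply: Xz0; rewrite E.
exists z => //=.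
have -> : z - (z0 + e) = (1 - e / (z - z0)) * (z - z0).
  by rewrite mulrBl divfK // mul1r opprD addrA.
have -> : `|e| = `|e / (z - z0)| * `|z - z0| by rewrite -normrM divfK.
rewrite normrM; congr (_ * _); set y := e / (z - z0) in line *.
apply: (@pexpIrn _ 2) => //; rewrite ?nnegrE //.
rewrite !normCK rmorphB rmorph1 /=.
have -> : (1 - y) * (1 - y^*) = 1 - (y + y^*) + y * y^* by ring.
by rewrite line subrr add0r.
Qed.

End Coordinate.

(** * Closed hexagons with equal ratios at opposite corners *)

Lemma Z6_add33 (k : 'Z_6) : k + 3 + 3 = k.
Proof. by apply: val_inj; case: k => [[|[|[|[|[|[|]]]]]]]. Qed.

Lemma Z6_add3_neq (k : 'Z_6) : k + 3 != k.
Proof. by case: k => [[|[|[|[|[|[|]]]]]]]. Qed.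

Lemma Z6_opposite_mem (k : 'Z_6) :
  k \notin [:: 1; 2; 3] -> k + 3 \in [:: 1; 2; 3].
Proof. by case: k => [[|[|[|[|[|[|]]]]]] //= m]; vm_compute. Qed.

(** The equalities at the corners 1 and 2 make the sides d_3, d_4, d_5 the
    multiples l d_0, l d_1, l d_2 of the opposite sides; closing up gives l = -1. *)
Lemma opposite_ratiosP (K : fieldType) (w : 'Z_6 -> K) :
  (forall k, w (k + 1) != w k) -> w 3 != w 0 ->
  let d k := w (k + 1) - w k in
  (forall k, k \in [:: 1; 2; 3] -> d k / d (k - 1) = d (k + 3) / d (k + 3 - 1)) <->
  (exists s, forall k, w k + w (k + 3) = s).
Proof.
move=> wS w30 d.
have d0 k : d k != 0 by rewrite subr_eq0.
split=> [Hd|[s Hs]]; last first.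
  have dN k : d (k + 3) = - d k.
    have := Hs (k + 1); rewrite addrAC -(Hs k) => E.
    transitivity (w (k + 1) + w (k + 3 + 1) - (w k + w (k + 3)) - d k).
      by rewrite /d; ring.
    by rewrite E subrr sub0r.
  by move=> k _; rewrite [k + 3 - 1]addrAC !dN invrN mulrNN.
have Z6E (j k : 'Z_6) : j = k :> nat -> j = k by exact: val_inj.
have s0 : 0 + 1 = 1 :> 'Z_6 by exact: Z6E.
have s1 : 1 + 1 = 2 :> 'Z_6 by exact: Z6E.
have s2 : 2 + 1 = 3 :> 'Z_6 by exact: Z6E.
have s3 : 3 + 1 = 4 :> 'Z_6 by exact: Z6E.
have s4 : 4 + 1 = 5 :> 'Z_6 by exact: Z6E.
have s5 : 5 + 1 = 0 :> 'Z_6 by exact: Z6E.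
have o1 : 1 + 3 = 4 :> 'Z_6 by exact: Z6E.
have o2 : 2 + 3 = 5 :> 'Z_6 by exact: Z6E.
have o3 : 3 + 3 = 0 :> 'Z_6 by exact: Z6E.
have e1 : d 1 / d 0 = d 4 / d 3.
  by have := Hd 1 isT; rewrite o1 -[in d (4 - 1)]s3 addrK subrr.
have e2 : d 2 / d 1 = d 5 / d 4.
  by have := Hd 2 isT; rewrite o2 -[in d (5 - 1)]s4 -[in d (2 - 1)]s1 !addrK.
pose l := d 3 / d 0.
have d3 : d 3 = l * d 0 by rewrite /l divfK.
have d4 : d 4 = l * d 1.
  by rewrite -[d 4](divfK (d0 3)) -e1 d3 mulrCA divfK.
have d5 : d 5 = l * d 2.
  by rewrite -[d 5](divfK (d0 4)) -e2 d4 mulrCA divfK.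
(* This product is the sum of all six sides. *)
have wE : (1 + l) * (w 3 - w 0) = 0.
  have -> : w 3 - w 0 = d 0 + d 1 + d 2.
    by rewrite /d s0 s1 s2; ring.
  transitivity (d 0 + d 1 + d 2 + (d 3 + d 4 + d 5)); first by rewrite d3 d4 d5; ring.
  by rewrite /d s0 s1 s2 s3 s4 s5; ring.
have l1 : l = - 1.
  apply/eqP; rewrite -addr_eq0 addrC; move/eqP: wE.
  by rewrite mulf_eq0 [w 3 - w 0 == 0]subr_eq0 (negPf w30) orbF.
have dN k : d (k + 3) = - d k.
  have H j : j \in [:: 1; 2; 3] -> d (j + 3) = - d j.
    by rewrite !inE => /or3P[] /eqP ->;
      rewrite ?o1 ?o2 ?o3 ?d3 ?d4 ?d5 l1 mulN1r ?opprK.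
  have [/H//|/Z6_opposite_mem/H] := boolP (k \in [:: 1; 2; 3]).
  by rewrite Z6_add33 => ->; rewrite opprK.
exists (w 0 + w 3) => k.
have step j : w (j + 1) + w (j + 1 + 3) = w j + w (j + 3).
  have := dN j; rewrite /d [j + 3 + 1]addrAC => E.
  apply/eqP; rewrite -subr_eq0; apply/eqP.
  transitivity ((w (j + 1 + 3) - w (j + 3)) + (w (j + 1) - w j)); first by ring.
  by rewrite E addNr.
have -> : k = (k : nat)%:R by rewrite natr_Zp.
elim: (k : nat) => [|n <-]; first by rewrite mulr0n add0r.
by rewrite -[n.+1%:R]natr1 step.
Qed.

(** * Flowers with distinct vertices *)

Section Flower.
Context {R : realType}.
Variables (z0 : R[i]) (z : 'Z_6 -> R[i]).
Hypothesis z_center : forall k, z k != z0.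
Hypothesis z_inj : injective z.

Let w k := pole_coord z0 (Some (z k)).

(** The hexagon of the w k is centrally symmetric, with center s / 2. *)
Definition constant_opposite_sums := exists s, forall k, w k + w (k + 3) = s.

Lemma flower_coord_inj : injective w.
Proof. by move=> j k /pole_coord_inj/z_inj. Qed.

Lemma opposite_neq k : z k != z (k + 3).
Proof. by apply: contra_neq (Z6_add3_neq k) => /z_inj. Qed.

Lemma conformally_symmetricP :
  conformally_symmetric z0 z <-> constant_opposite_sums.
Proof.
split=> [[M [Mm Mi M0 Mz]]|[s Hs]].
  have [s Hs] := mobius_involutive_half_turn Mm Mi M0.
  by exists s => k; apply: Hs => //; exact: opposite_neq.
have [M [Mm Mi M0 Mz]] := mobius_half_turn z0 s.
by exists M; split=> // k; apply: Mz => //; exact: Hs.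
Qed.

Lemma second_common_pointP :
  (exists C : 'Z_6 -> set (sphere R),
      (forall k, k \in [:: 1; 2; 3] ->
         [/\ circle_or_line (C k), C k (Some (z k)), C k (Some z0) &
             C k (Some (z (k + 3)))]) /\
      exists X : sphere R,
        [/\ X <> Some z0,
            forall k, k \in [:: 1; 2; 3] -> C k X &
            forall k, k \in [:: 1; 2; 3] ->
              cr (Some (z k)) (Some z0) (Some (z (k + 3))) X = Some (- 1)])
  <-> constant_opposite_sums.
Proof.
split=> [[C [_ [X [X0 _ HX]]]]|[s Hs]].
  have H k : k \in [:: 1; 2; 3] -> w k + w (k + 3) = 2 * pole_coord z0 X.
    by move=> /HX /cr_harmonicP; apply=> //; exact: opposite_neq.
  exists (2 * pole_coord z0 X) => k.
  have [/H//|/Z6_opposite_mem/H] := boolP (k \in [:: 1; 2; 3]).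
  by rewrite Z6_add33 addrC.
have [X X0 HX] := pole_coord_surj z0 (s / 2).
have w0 k : w (k + 3) - w k != 0.
  by rewrite subr_eq0 (inj_eq flower_coord_inj) Z6_add3_neq.
have [C HC] := choice (fun k => circle_or_line_coord_line z0 (w k) (w0 k)).
have fin_neq k : Some (z k) <> Some z0 by case; apply/eqP.
exists C; split=> [k _|].
  have [Ck C0 CX] := HC k; split=> //.
  - by apply: (CX _ 0) => //; rewrite mul0r addr0.
  - by apply: (CX _ 1) => //; rewrite mul1r [RHS]addrC subrK.
exists X; split=> // k _; last first.
  apply/cr_harmonicP => //; first exact: opposite_neq.
  by rewrite -/(w _) -/(w _) Hs HX mulrC divfK // pnatr_eq0.
have [_ _ CX] := HC k; apply: (CX _ 2^-1) => //.
rewrite HX -(Hs k) fmorphV rmorph_nat.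
by field; rewrite ?pnatr_eq0.
Qed.

End Flower.

(** * The cross-ratio function of an immersed flower *)

Section Cross_ratio_function.
Context {R : realType}.
Variables (L : tri_lattice R) (TL : set face) (F : R[i] -> R[i]).
Variables (v0 : R[i]) (v : 'Z_6 -> R[i]).
Hypothesis F_immersion : discrete_immersion L TL F.
Hypothesis v0_interior : interior_vertex L TL v0.
Hypothesis v_neighbors : cyclic_neighbors L TL v0 v.

Let z0 := F v0.
Let z k := F (v k).

Lemma neighbor_face k : exists s, ccw_face L TL v0 (v k) s.
Proof.
have [_ [H|H]] := v_neighbors; first by exists (v (k + 1)).
by exists (v (k - 1)); have := H (k - 1); rewrite subrK.
Qed.

Lemma flower_image_center k : z k != z0.
Proof.
have [s fs] := neighbor_face k.
have := ccw_face_neq fs; rewrite eq_sym; apply: contra_neq => E.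
by apply: (ccw_face_inj F_immersion v0_interior fs fs _ _ E); rewrite !inE eqxx ?orbT.
Qed.

Lemma flower_image_inj : injective z.
Proof.
move=> j k E; have [v_inj _] := v_neighbors; apply: v_inj.
have [s fs] := neighbor_face j; have [t ft] := neighbor_face k.
by apply: (ccw_face_inj F_immersion v0_interior fs ft _ _ E); rewrite !inE eqxx ?orbT.
Qed.

Let w k := pole_coord z0 (Some (z k)).

Lemma opposite_cross_ratiosP :
  (forall k : 'Z_6, k \in [:: 1; 2; 3] ->
     cross_ratio_function L TL F v0 (v k) =
     cross_ratio_function L TL F v0 (v (k + 3))) <->
  constant_opposite_sums z0 z.
Proof.
have zc := flower_image_center; have zi := flower_image_inj.
have wi : injective w := flower_coord_inj zi.
have succ_neq (k : 'Z_6) : k + 1 != k by rewrite -subr_eq0 addrAC subrr.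
have wS k : w (k + 1) != w k by rewrite (inj_eq wi).
have w30 : w 3 != w 0 by rewrite (inj_eq wi).
apply: iff_trans (opposite_ratiosP wS w30).
pose r k := (w (k + 1) - w k) / (w k - w (k - 1)).
have rE k : (w (k + 1) - w k) / (w (k - 1 + 1) - w (k - 1)) = r k.
  by rewrite subrK.
have zS k : z (k + 1) != z k by rewrite (inj_eq zi).
have zP k : z (k - 1) != z k by rewrite -{2}[k](subrK 1) eq_sym.
(* Listing the neighbors in the other direction replaces the cross-ratio by its
   inverse; both forms are injective functions of r k. *)
have [f [finj qE]] : exists f : R[i] -> R[i], injective f /\
    forall k, cross_ratio_function L TL F v0 (v k) = Some (f (r k)).
  have [_ [H|H]] := v_neighbors.
    exists -%R; split=> [|k]; first exact: oppr_inj.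
    have Hl := H (k - 1); rewrite subrK in Hl.
    rewrite /cross_ratio_function (left_apexE (H k)).
    rewrite (left_apexE (ccw_face_rot Hl)).
    exact: cr_center (zc _) (zc _) (zc _) (zP _).
  exists (fun x => - x^-1); split=> [|k]; first by move=> x y /oppr_inj/invr_inj.
  have Hr := H (k - 1); rewrite subrK in Hr.
  rewrite /cross_ratio_function (left_apexE Hr).
  rewrite (left_apexE (ccw_face_rot (H k))).
  apply: etrans (cr_center (zc _) (zc _) (zc _) (zS _)) _.
  by rewrite -!/(w _) /r invf_div -[w k - w (k - 1)]opprB -[w (k + 1) - w k]opprB
     invrN mulrNN.
split=> Hk k kin.
  by rewrite !rE; apply: finj; have := Hk k kin; rewrite !qE => -[].
by rewrite !qE -!rE Hk.
Qed.

End Cross_ratio_function.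

Theorem theorem3p3 (R : realType) (L : tri_lattice R) (TL : set face)
    (F : R[i] -> R[i]) (v0 : R[i]) (v : 'Z_6 -> R[i])
    (F_immersion : discrete_immersion L TL F)
    (v0_interior : interior_vertex L TL v0)
    (v_neighbors : cyclic_neighbors L TL v0 v) :
  let q := cross_ratio_function L TL F in
  let z0 := F v0 in
  let z k := F (v k) in
  let opposite_cross_ratios_agree :=
    forall k : 'Z_6, k \in [:: 1; 2; 3] -> q v0 (v k) = q v0 (v (k + 3)) in
  let second_common_point :=
    exists C : 'Z_6 -> set (sphere R),
      (forall k, k \in [:: 1; 2; 3] ->
         [/\ circle_or_line (C k), C k (Some (z k)), C k (Some z0) &
             C k (Some (z (k + 3)))]) /\
      exists X : sphere R,
        [/\ X <> Some z0,
            forall k, k \in [:: 1; 2; 3] -> C k X &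
            forall k, k \in [:: 1; 2; 3] ->
              cr (Some (z k)) (Some z0) (Some (z (k + 3))) X = Some (- 1)] in
  (conformally_symmetric z0 z <-> opposite_cross_ratios_agree) /\
  (conformally_symmetric z0 z <-> second_common_point).
Proof.
move=> q z0 z oppo secp.
have zc : forall k, z k != z0.
  exact: flower_image_center F_immersion v0_interior v_neighbors.
have zi : injective z.
  exact: flower_image_inj F_immersion v0_interior v_neighbors.
have E1 := conformally_symmetricP zc zi.
have E2 : oppo <-> constant_opposite_sums z0 z.
  exact: opposite_cross_ratiosP F_immersion v0_interior v_neighbors.
have E3 : secp <-> constant_opposite_sums z0 z.
  exact: second_common_pointP zc zi.
by split; apply: iff_trans E1 _; apply: iff_sym.
Qed.
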